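(* Let $r,L_y,L_z,\bar P>0$, $\xi\in(0,1]$, $\theta\in(0,\pi)$ and $\phi=0$, and let $\gamma$ be the closed-form SNR of the context. Consider in $\mathbb R^3$ the points $O=(r\sin\theta,\,0,\,r\cos\theta)$ (user location), $O'=(0,0,r\cos\theta)$ (the projection of $O$ onto the $z$-axis), and the four corners of the right half of the array $D_5=(0,\frac{L_y}{2},\frac{L_z}{2})$, $D_6=(0,\frac{L_y}{2},-\frac{L_z}{2})$, $D_7=(0,0,-\frac{L_z}{2})$, $D_8=(0,0,\frac{L_z}{2})$. Define the angles $\eta_3=\angle D_8OO'$, $\eta_4=\angle D_7OO'$, $\beta_3=\angle D_5OD_8$ and $\beta_4=\angle D_6OD_7$. Then $$\gamma=\frac{\xi\bar P}{2\pi}\left[(-1)^i\arctan(\tan\eta_3\sin\beta_3)+(-1)^j\arctan(\tan\eta_4\sin\beta_4)\right],$$ where $(i,j)=(0,1)$ if $r\cos\theta<-\frac{L_z}{2}$, $(i,j)=(0,0)$ if $-\frac{L_z}{2}\le r\cos\theta\le\frac{L_z}{2}$, and $(i,j)=(1,0)$ if $r\cos\theta>\frac{L_z}{2}$.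
   Context: For a planar array of physical dimensions $L_y\times L_z$ in the $y$-$z$ plane centred at the origin, with array occupation ratio $\xi$ and transmit SNR $\bar P$, and a user at distance $r$ with zenith angle $\theta\in(0,\pi)$ and azimuth angle $\phi\in(-\frac{\pi}{2},\frac{\pi}{2})$, i.e. located at $(r\Psi,r\Phi,r\Omega)$ with $\Psi=\sin\theta\cos\phi$, $\Phi=\sin\theta\sin\phi$, $\Omega=\cos\theta$, the closed-form SNR is $$\gamma=\frac{\xi\bar P}{4\pi}\left[U\!\left(\tfrac{L_y}{2r}-\Phi,\tfrac{L_z}{2r}-\Omega\right)+U\!\left(\tfrac{L_y}{2r}+\Phi,\tfrac{L_z}{2r}-\Omega\right)+U\!\left(\tfrac{L_y}{2r}-\Phi,\tfrac{L_z}{2r}+\Omega\right)+U\!\left(\tfrac{L_y}{2r}+\Phi,\tfrac{L_z}{2r}+\Omega\right)\right],$$ with $U(x,y)=\arctan\!\left(\dfrac{xy}{\Psi\sqrt{\Psi^2+x^2+y^2}}\right)$. $\angle XYZ\in[0,\pi]$ denotes the unoriented angle at vertex $Y$. *)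

(* Defs.v *)
From HB Require Import structures.
From mathcomp Require Import all_boot all_order all_algebra.
From mathcomp Require Import reals trigo.
Set Implicit Arguments.
Unset Strict Implicit.
Unset Printing Implicit Defensive.
Import Order.TTheory GRing.Theory Num.Theory.
Local Open Scope ring_scope.

Definition point3 (R : realType) (a b c : R) : 'rV[R]_3 :=
  \row_(k < 3) [:: a; b; c]`_k.

Definition dot (R : realType) (n : nat) (u v : 'rV[R]_n) : R :=
  \sum_(k < n) u 0 k * v 0 k.

(* The norm `|u| that MathComp-Analysis puts on row vectors is the sup norm;
   angles need the Euclidean one. *)
Definition enorm (R : realType) (n : nat) (u : 'rV[R]_n) : R :=
  Num.sqrt (dot u u).

(* The unoriented angle XYZ at the vertex Y, in [0, pi].  When X = Y or Z = Y
   the quotient is 0 by convention, so that the value is pi / 2. *)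
Definition angle (R : realType) (n : nat) (X Y Z : 'rV[R]_n) : R :=
  acos (dot (X - Y) (Z - Y) / (enorm (X - Y) * enorm (Z - Y))).

(* Direction cosines of the user along the x-, y- and z-axes; the user is
   located at (r Psi, r Phi, r Omega) and the array lies in the y-z plane. *)
Definition Psi (R : realType) (theta phi : R) : R := sin theta * cos phi.
Definition Phi (R : realType) (theta phi : R) : R := sin theta * sin phi.
Definition Omega (R : realType) (theta : R) : R := cos theta.

Definition U (R : realType) (psi x y : R) : R :=
  atan (x * y / (psi * Num.sqrt (psi ^+ 2 + x ^+ 2 + y ^+ 2))).

(* Closed-form SNR of an Ly x Lz planar array centred at the origin, with
   occupation ratio xi and transmit SNR P. *)
Definition snr (R : realType) (xi P Ly Lz r theta phi : R) : R :=
  let V := U (Psi theta phi) in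
  let ph := Phi theta phi in
  let om := Omega theta in
  xi * P / (4 * pi) *
    (V (Ly / (2 * r) - ph) (Lz / (2 * r) - om) +
     V (Ly / (2 * r) + ph) (Lz / (2 * r) - om) +
     V (Ly / (2 * r) - ph) (Lz / (2 * r) + om) +
     V (Ly / (2 * r) + ph) (Lz / (2 * r) + om)).

(* Main.v *)
Require Import Defs.
From HB Require Import structures.
From mathcomp Require Import all_boot all_order all_algebra.
From mathcomp Require Import reals trigo.
From mathcomp Require Import ring lra.
Set Implicit Arguments.
Unset Strict Implicit.
Unset Printing Implicit Defensive.
Import Order.TTheory GRing.Theory Num.Theory.
Local Open Scope ring_scope.

(* With phi = 0 the four terms of the SNR collapse to two, one for each end
   (0, 0, z) of the z-axis segment of the array.  The triangle (D8, O', O) has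
   a right angle at O' and the triangle (D5, D8, O) has one at D8 (likewise
   D7 and D6, D7), so
     tan eta = |z - r cos theta| / (r sin theta),
     sin beta = (Ly / 2) / |D5 - O|,
   and their product is, up to the sign of z - r cos theta, the argument of
   the arctangent in U.  The signs (-1)^i, (-1)^j undo the absolute values. *)

Lemma dot_ge0 (R : realType) n (u : 'rV[R]_n) : 0 <= dot u u.
Proof. by apply: sumr_ge0 => k _; rewrite -expr2 sqr_ge0. Qed.

Lemma dotBl (R : realType) n (u v w : 'rV[R]_n) :
  dot (u - v) w = dot u w - dot v w.
Proof.
by rewrite /dot -sumrB; apply: eq_bigr => k _; rewrite !mxE mulrBl.
Qed.

Lemma dotC (R : realType) n (u v : 'rV[R]_n) : dot u v = dot v u.
Proof. by apply: eq_bigr => k _; rewrite mulrC. Qed.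

Lemma sqr_enorm (R : realType) n (u : 'rV[R]_n) : enorm u ^+ 2 = dot u u.
Proof. by rewrite sqr_sqrtr ?dot_ge0. Qed.

Lemma point3B (R : realType) (a b c a' b' c' : R) :
  point3 a b c - point3 a' b' c' = point3 (a - a') (b - b') (c - c').
Proof. by apply/rowP => -[[|[|[|//]]] lti]; rewrite !mxE. Qed.

Lemma dot_point3 (R : realType) (a b c a' b' c' : R) :
  dot (point3 a b c) (point3 a' b' c') = a * a' + b * b' + c * c'.
Proof. by rewrite /dot !big_ord_recr big_ord0 /= !mxE /= add0r. Qed.

Section RightTriangle.
Variables (R : realType) (n : nat) (X Y Z : 'rV[R]_n).
Hypothesis YZ_gt0 : 0 < enorm (Z - Y).
Hypothesis right_angle : dot (X - Z) (Z - Y) = 0.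

(** Split [X - Y] as [(X - Z) + (Z - Y)]: the first summand is orthogonal to the leg [Z - Y], so
    only the second one contributes. *)
Let dot_proj : dot (X - Y) (Z - Y) = enorm (Z - Y) ^+ 2.
Proof.
have -> : X - Y = (X - Z) - (Y - Z) by rewrite opprB addrA subrK.
by rewrite dotBl right_angle -(opprB Z Y) -(sub0r (Z - Y)) dotBl
  -sqr_enorm (_ : dot 0 _ = 0) ?sub0r ?opprK // /dot big1 // => k _;
  rewrite mxE mul0r.
Qed.

Lemma pythagoras :
  enorm (X - Y) ^+ 2 = enorm (X - Z) ^+ 2 + enorm (Z - Y) ^+ 2.
Proof.
have XZE : X - Z = (X - Y) - (Z - Y) by rewrite opprB addrA subrK.
rewrite (sqr_enorm (X - Z)) {2}XZE dotC dotBl (dotC (Z - Y)) right_angle subr0.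
by rewrite XZE dotC dotBl -sqr_enorm (dotC (Z - Y)) dot_proj subrK.
Qed.

Let XY_gt0 : 0 < enorm (X - Y).
Proof.
rewrite lt_def sqrtr_ge0 andbT -sqrf_eq0 pythagoras gt_eqF //.
by rewrite ltr_wpDl ?sqr_ge0 ?exprn_gt0.
Qed.

Let cosE : dot (X - Y) (Z - Y) / (enorm (X - Y) * enorm (Z - Y)) =
  enorm (Z - Y) / enorm (X - Y).
Proof. by rewrite dot_proj; field; rewrite !gt_eqF. Qed.

(** [acos] inverts [cos] only for arguments in [-1, 1]. The upper bound says that a leg is no longer
    than the hypotenuse. *)
Let cos_bounds : -1 <= enorm (Z - Y) / enorm (X - Y) <= 1.
Proof.
apply/andP; split.
  by rewrite (le_trans (lerN10 _)) // divr_ge0 // ltW.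
rewrite ler_pdivrMr // mul1r -(@ler_pXn2r _ 2) ?nnegrE ?sqrtr_ge0 //.
by rewrite pythagoras lerDr sqr_ge0.
Qed.

Lemma cos_angle_right : cos (angle X Y Z) = enorm (Z - Y) / enorm (X - Y).
Proof. by rewrite /angle cosE acosK // in_itv. Qed.

Lemma sin_angle_right : sin (angle X Y Z) = enorm (X - Z) / enorm (X - Y).
Proof.
rewrite /angle cosE sin_acos //.
(* [sin_acos] leaves the root of 1 minus the squared cosine. The nonnegative right side becomes the
   root of its square, so that only radicands remain to be compared. *)
rewrite -[RHS]ger0_norm ?divr_ge0 ?sqrtr_ge0 // -sqrtr_sqr; congr Num.sqrt.
have XZE : enorm (X - Z) ^+ 2 = enorm (X - Y) ^+ 2 - enorm (Z - Y) ^+ 2.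
  by rewrite pythagoras addrK.
by rewrite !expr_div_n XZE; field; rewrite gt_eqF.
Qed.

Lemma tan_angle_right : tan (angle X Y Z) = enorm (X - Z) / enorm (Z - Y).
Proof.
by rewrite /tan cos_angle_right sin_angle_right; field; rewrite !gt_eqF.
Qed.

End RightTriangle.

Lemma UN (R : realType) (psi x y : R) : U psi x (- y) = - U psi x y.
Proof. by rewrite /U sqrrN mulrN mulNr atanN. Qed.

(** One computation for both ends of the segment: it is used with [s] = sin theta, [d] = r cos
    theta, [l] = Ly / 2 and [z] = Lz / 2 or its opposite. The absolute value is the length of the
    leg opposite to eta. If [z = d], that leg vanishes and both sides are 0. *)
Lemma atan_tan_sin_corner (R : realType) (r s d l z : R) :
  0 < r -> 0 < s -> 0 <= l ->
  let O := point3 (r * s) 0 d in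
  atan (tan (angle (point3 0 0 z) O (point3 0 0 d)) *
        sin (angle (point3 0 l z) O (point3 0 0 z))) =
  U s (l / r) (`|z - d| / r).
Proof.
move=> r_gt0 s_gt0 l_ge0 O.
have rs_gt0 : 0 < r * s by rewrite mulr_gt0.
have OO' : enorm (point3 0 0 d - O) = r * s.
  rewrite /enorm point3B dot_point3 -[RHS]gtr0_norm // -sqrtr_sqr.
  by congr Num.sqrt; ring.
(* The offset [r * s] along the x-axis keeps this leg nonzero even when [z = d]. *)
have DO_gt0 : 0 < enorm (point3 0 0 z - O).
  rewrite /enorm point3B dot_point3 sqrtr_gt0 !subrr sub0r mulr0 addr0 mulrNN.
  by rewrite ltr_pwDl ?mulr_gt0 // -expr2 sqr_ge0.
rewrite tan_angle_right ?OO' //; last by rewrite !point3B dot_point3; ring.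
rewrite sin_angle_right //; last by rewrite !point3B dot_point3; ring.
rewrite /U; congr atan.
have -> : enorm (point3 0 0 z - point3 0 0 d) = `|z - d|.
  by rewrite /enorm point3B dot_point3 -sqrtr_sqr; congr Num.sqrt; ring.
have -> : enorm (point3 0 l z - point3 0 0 z) = l.
  rewrite /enorm point3B dot_point3 -[RHS]ger0_norm // -sqrtr_sqr.
  by congr Num.sqrt; ring.
(* Factoring out [r] rescales the hypotenuse to the normalized lengths that occur in [U]. *)
have -> : enorm (point3 0 l z - O) =
    r * Num.sqrt (s ^+ 2 + (l / r) ^+ 2 + (`|z - d| / r) ^+ 2).
  rewrite -[X in X * Num.sqrt _](gtr0_norm r_gt0) -sqrtr_sqr -sqrtrM ?sqr_ge0 //.
  rewrite /enorm point3B dot_point3; congr Num.sqrt.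
  by rewrite !expr_div_n real_normK ?num_real //; field; rewrite gt_eqF.
have S_gt0 : 0 < Num.sqrt (s ^+ 2 + (l / r) ^+ 2 + (`|z - d| / r) ^+ 2).
  by rewrite sqrtr_gt0 -addrA ltr_pwDl ?exprn_gt0 // addr_ge0 ?sqr_ge0.
by field; rewrite !gt_eqF.
Qed.

Theorem lemma2 (R : realType) (r Ly Lz P xi theta phi : R)
  (hr : 0 < r) (hLy : 0 < Ly) (hLz : 0 < Lz) (hP : 0 < P)
  (hxi : 0 < xi <= 1) (htheta : 0 < theta < pi) (hphi : phi = 0) :
  let O := point3 (r * sin theta) 0 (r * cos theta) in
  let O' := point3 0 0 (r * cos theta) in
  let D5 := point3 0 (Ly / 2) (Lz / 2) in
  let D6 := point3 0 (Ly / 2) (- (Lz / 2)) in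
  let D7 := point3 0 0 (- (Lz / 2)) in
  let D8 := point3 0 0 (Lz / 2) in
  let eta3 := angle D8 O O' in
  let eta4 := angle D7 O O' in
  let beta3 := angle D5 O D8 in
  let beta4 := angle D6 O D7 in
  let rhs (i j : nat) :=
    xi * P / (2 * pi) *
      ((-1) ^+ i * atan (tan eta3 * sin beta3) +
       (-1) ^+ j * atan (tan eta4 * sin beta4)) in
  [/\ r * cos theta < - (Lz / 2) ->
        snr xi P Ly Lz r theta phi = rhs 0%N 1%N,
      - (Lz / 2) <= r * cos theta <= Lz / 2 ->
        snr xi P Ly Lz r theta phi = rhs 0%N 0%N
    & Lz / 2 < r * cos theta ->
        snr xi P Ly Lz r theta phi = rhs 1%N 0%N].
Proof.
move=> O O' D5 D6 D7 D8 eta3 eta4 beta3 beta4 rhs.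
have s_gt0 : 0 < sin theta by rewrite sin_gt0_pi.
have l_ge0 : 0 <= Ly / 2 by rewrite divr_ge0 // ltW.
have E3 := atan_tan_sin_corner (r * cos theta) (Lz / 2) hr s_gt0 l_ge0.
have E4 := atan_tan_sin_corner (r * cos theta) (- (Lz / 2)) hr s_gt0 l_ge0.
(* [u] takes a signed height offset from the user and is odd, so a sign in front of it can move
   inside its argument. *)
pose u y := U (sin theta) (Ly / 2 / r) (y / r).
have uN y : u (- y) = - u y by rewrite /u mulNr UN.
have snrE : snr xi P Ly Lz r theta phi = xi * P / (2 * pi) *
    (u (Lz / 2 - r * cos theta) + u (Lz / 2 + r * cos theta)).
  rewrite /snr /Psi /Phi /Omega hphi cos0 sin0 mulr1 mulr0 subr0 addr0.
  have -> : Ly / (2 * r) = Ly / 2 / r by field; rewrite gt_eqF.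
  have -> : Lz / (2 * r) - cos theta = (Lz / 2 - r * cos theta) / r.
    by field; rewrite gt_eqF.
  have -> : Lz / (2 * r) + cos theta = (Lz / 2 + r * cos theta) / r.
    by field; rewrite gt_eqF.
  rewrite -/(u _) -/(u _).
  (* pi is generalized because field would unfold it. *)
  by move: (pi : R) (pi_gt0 R) => p p_gt0; field; rewrite gt_eqF.
rewrite snrE /rhs /eta3 /eta4 /beta3 /beta4 E3 E4 -/(u _) -/(u _).
(* The offset of the lower end is the opposite of [Lz / 2 + r * cos theta]; under the absolute value
   it matches the second term of [snrE]. *)
rewrite -opprD normrN expr0 expr1 !mul1r !mulN1r.
(* Each regime leaves two goals, upper end first: a signed offset equals plus or minus its absolute
   value. *)
split=> [lt | /andP[ge le] | gt]; congr (_ * (_ + _)); rewrite -?uN; congr u.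
- by rewrite ger0_norm //; lra.
- by rewrite ltr0_norm ?opprK //; lra.
- by rewrite ger0_norm //; lra.
- by rewrite ger0_norm //; lra.
- by rewrite ltr0_norm ?opprK //; lra.
- by rewrite ger0_norm //; lra.
Qed.
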